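(* Let $f:\mathbb{R}^n\to\mathbb{R}$ be continuously differentiable and pseudo-convex, and let $\{x_k\}$ be an infinite sequence generated by Algorithm TBB (in any of its six variants) applied to the problem $\min_{x\in\mathbb{R}^n} f(x)$, with step sizes satisfying $\sup\{\lambda_k: k=1,2,\dots\}<+\infty$. Then: (i) $\{x_k\}$ is a bounded sequence if and only if the solution set of $\min_{x\in\mathbb{R}^n} f(x)$ is nonempty; (ii) $\lim_{k\to\infty}f(x_k)=\inf\{f(x):x\in\mathbb{R}^n\}$; (iii) if the solution set of $\min_{x\in\mathbb{R}^n} f(x)$ is nonempty, then any accumulation point $x_*$ of $\{x_k\}$ is an optimal solution of this problem and $\lim_{k\to\infty}x_k=x_*$.
   Context: A differentiable $f$ is pseudo-convex if $f(y)<f(x)$ implies $\nabla f(x)^T(y-x)<0$ for all $x,y\in\mathbb{R}^n$. Algorithm TBB (three-point step size gradient method with relaxed generalized Armijo step size rule). Write $g_k=\nabla f(x_k)$. Parameters: $\mu_1,\mu_2\in(0,1)$ with $\mu_1\le\mu_2$; $\gamma_1,\gamma_2>0$; $\sigma_1\in(0,1)$; $\sigma_2\in(1,2)$; $0<\alpha_{\min}<\alpha_{\max}$; $0<\omega<1$. Start from $x_{-1}=x_0\in\mathbb{R}^n$ and $\bar\alpha_0=1$, $k=0$. At iteration $k$: (1) If $g_k=0$, stop; otherwise set $d_k=-\bar\alpha_k g_k$. (2) Choose a number $L_k$ with $0\le L_k\le \bar\alpha_k(-g_k^Td_k)/\|d_k\|^2$. Set $x_{k+1}=x_k+\lambda_kd_k$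 with $\lambda_k=\omega^{p_k}$, where $p_k$ is the smallest non-negative integer for which $\lambda_k$ satisfies both (a) $f(x_k+\lambda_kd_k)\le f(x_k)+\mu_1\lambda_k\left(g_k^Td_k+\frac{1}{2\bar\alpha_k}L_k\|d_k\|^2\right)$, and (b) $\lambda_k\ge\gamma_1$, or $\lambda_k\ge\gamma_2\lambda_k^*>0$ for some $\lambda_k^*$ with $f(x_k+\lambda_k^*d_k)>f(x_k)+\mu_2\lambda_k^*\left(g_k^Td_k+\frac{1}{2\bar\alpha_k}L_k\|d_k\|^2\right)$. (3) Replace $k$ by $k+1$. With $s_{k-1}=x_k-x_{k-1}$, $s_{k-2}=x_k-x_{k-2}$, $y_{k-1}=g_k-g_{k-1}$, $y_{k-2}=g_k-g_{k-2}$, let $\beta_k=\frac{s_{k-1}^Ty_{k-1}}{\|y_{k-1}\|^2}$ and let $\alpha_k$ be given by one fixed choice among the following six formulas (one per variant): BB1: $\alpha_k=\alpha_k^{BB_1}:=\frac{\|s_{k-1}\|^2}{s_{k-1}^Ty_{k-1}}$; BB2: $\alpha_k=\alpha_k^{BB_2}:=\frac{s_{k-1}^Ty_{k-1}}{\|y_{k-1}\|^2}$; TBB1: $\alpha_k=\frac{\|s_{k-1}\|^2+\|s_{k-2}\|^2}{s_{k-1}^Ty_{k-1}+s_{k-2}^Ty_{k-2}}$; TBB2: $\alpha_k=\frac{s_{k-1}^Ty_{k-1}+s_{k-2}^Ty_{k-2}}{\|y_{k-1}\|^2+\|y_{k-2}\|^2}$; TBB1$'$: $\alpha_k=\lambda\alpha_k^{BB_1}+(1-\lambda)\alpha_k^{BB_2}$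 with $\lambda=\left(\frac{\|s_{k-2}\|^2}{y_{k-2}^Ts_{k-2}}-\alpha_k^{BB_2}\right)/(\alpha_k^{BB_1}-\alpha_k^{BB_2})$; TBB2$'$: $\alpha_k=\lambda\alpha_k^{BB_1}+(1-\lambda)\alpha_k^{BB_2}$ with $\lambda=\left(\frac{y_{k-2}^Ts_{k-2}}{\|y_{k-2}\|^2}-\alpha_k^{BB_2}\right)/(\alpha_k^{BB_1}-\alpha_k^{BB_2})$. Put $\bar\alpha_{\min}=\max\{\alpha_{\min},\sigma_1|\beta_k|\}$ and $\bar\alpha_{\max}=\min\{\alpha_{\max},\sigma_2|\beta_k|\}$. Set $\bar\alpha_k=\alpha_k$ if $\bar\alpha_{\min}\le\alpha_k\le\bar\alpha_{\max}$; $\bar\alpha_k=\bar\alpha_{\min}$ if $\alpha_k<\bar\alpha_{\min}$; $\bar\alpha_k=\bar\alpha_{\max}$ if $\alpha_k>\bar\alpha_{\max}$. Return to (1). Standing assumptions: all quantities above are well defined at every iteration and the algorithm does not stop, so that $\{x_k\}$ is infinite; $\alpha_{\min}\le\beta_k\le\alpha_{\max}$ for all $k\ge1$, and $\alpha_{\min}\le 1\le\alpha_{\max}$. (Consequently $\alpha_{\min}\le\bar\alpha_k\le\alpha_{\max}$ for all $k$.) *)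

(* Defs.v *)
From mathcomp Require Import all_boot all_order all_algebra.
From mathcomp Require Import boolp classical_sets reals ereal topology.
From mathcomp Require Import normedtype sequences derive.
Set Implicit Arguments.
Unset Strict Implicit.
Unset Printing Implicit Defensive.
Import Order.TTheory GRing.Theory Num.Theory.
Import numFieldNormedType.Exports.
Local Open Scope classical_set_scope.
Local Open Scope ring_scope.

(* The norm `|_| that the library puts on 'rV[R]_n is the sup norm, so the
   Euclidean inner product and squared norm are introduced separately. The
   topology (limits, accumulation points, boundedness, differentiability) is
   the same for both norms. *)
Definition dot (R : realType) (n : nat) (u v : 'rV[R]_n) : R :=
  \sum_(i < n) u 0 i * v 0 i.

Definition sqn (R : realType) (n : nat) (u : 'rV[R]_n) : R := dot u u.

Definition grad (R : realType) (n : nat) (f : 'rV[R]_n -> R) (x : 'rV[R]_n) :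
    'rV[R]_n :=
  \row_(i < n) 'D_(delta_mx 0 i) f x.

Definition continuously_differentiable (R : realType) (n : nat)
    (f : 'rV[R]_n -> R) : Prop :=
  (forall x : 'rV[R]_n, differentiable f x) /\ continuous (grad f).

Definition pseudo_convex (R : realType) (n : nat) (f : 'rV[R]_n -> R) : Prop :=
  (forall x : 'rV[R]_n, differentiable f x) /\
  forall x y : 'rV[R]_n, f y < f x -> dot (grad f x) (y - x) < 0.

Definition solutions (R : realType) (n : nat) (f : 'rV[R]_n -> R) :
    set 'rV[R]_n :=
  [set x | forall y, f x <= f y].

Record tbb_params (R : realType) := TBBParams {
  mu1 : R; mu2 : R;
  gamma1 : R; gamma2 : R;
  sigma1 : R; sigma2 : R;
  amin : R; amax : R;
  omega : R
}.

Record valid_params (R : realType) (P : tbb_params R) : Prop := ValidParams {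
  mu1_itv : 0 < mu1 P < 1;
  mu2_itv : 0 < mu2 P < 1;
  mu12_le : mu1 P <= mu2 P;
  gamma1_gt0 : 0 < gamma1 P;
  gamma2_gt0 : 0 < gamma2 P;
  sigma1_itv : 0 < sigma1 P < 1;
  sigma2_itv : 1 < sigma2 P < 2;
  amin_gt0 : 0 < amin P;
  amin_lt_amax : amin P < amax P;
  omega_itv : 0 < omega P < 1
}.

Inductive variant := BB1 | BB2 | TBB1 | TBB2 | TBB1' | TBB2'.

(* Step size formulas. In an iteration of index k,
   s1 = x_k - x_(k-1), s2 = x_k - x_(k-2),
   y1 = g_k - g_(k-1), y2 = g_k - g_(k-2). *)
Definition alphaBB1 (R : realType) (n : nat) (s1 y1 : 'rV[R]_n) : R :=
  sqn s1 / dot s1 y1.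

Definition alphaBB2 (R : realType) (n : nat) (s1 y1 : 'rV[R]_n) : R :=
  dot s1 y1 / sqn y1.

Definition combineBB (R : realType) (n : nat) (c : R) (s1 y1 : 'rV[R]_n) : R :=
  let a1 := alphaBB1 s1 y1 in
  let a2 := alphaBB2 s1 y1 in
  let l := (c - a2) / (a1 - a2) in
  l * a1 + (1 - l) * a2.

Definition alpha_of (R : realType) (n : nat) (v : variant)
    (s1 y1 s2 y2 : 'rV[R]_n) : R :=
  match v with
  | BB1 => alphaBB1 s1 y1
  | BB2 => alphaBB2 s1 y1
  | TBB1 => (sqn s1 + sqn s2) / (dot s1 y1 + dot s2 y2)
  | TBB2 => (dot s1 y1 + dot s2 y2) / (sqn y1 + sqn y2)
  | TBB1' => combineBB (sqn s2 / dot y2 s2) s1 y1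
  | TBB2' => combineBB (dot y2 s2 / sqn y2) s1 y1
  end.

(* Division is total with z / 0 = 0, so that the quotients entering alpha_of
   are well defined has to be said explicitly. *)
Definition alpha_defined (R : realType) (n : nat) (v : variant)
    (s1 y1 s2 y2 : 'rV[R]_n) : Prop :=
  match v with
  | BB1 => dot s1 y1 != 0
  | BB2 => sqn y1 != 0
  | TBB1 => dot s1 y1 + dot s2 y2 != 0
  | TBB2 => sqn y1 + sqn y2 != 0
  | TBB1' => [/\ dot s1 y1 != 0, sqn y1 != 0, dot y2 s2 != 0
               & alphaBB1 s1 y1 - alphaBB2 s1 y1 != 0]
  | TBB2' => [/\ dot s1 y1 != 0, sqn y1 != 0, sqn y2 != 0
               & alphaBB1 s1 y1 - alphaBB2 s1 y1 != 0]
  end.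

Definition safeguard (R : realType) (P : tbb_params R) (beta alpha : R) : R :=
  let lo := Num.max (amin P) (sigma1 P * `|beta|) in
  let hi := Num.min (amax P) (sigma2 P * `|beta|) in
  if lo <= alpha <= hi then alpha else if alpha < lo then lo else hi.

(* The bound appearing, with mu = mu1 in the sufficient decrease condition and
   with mu = mu2 in the condition excluding too small steps, of the relaxed
   generalized Armijo rule at the point x in direction d. *)
Definition armijo_rhs (R : realType) (n : nat) (f : 'rV[R]_n -> R)
    (x d : 'rV[R]_n) (abar L mu t : R) : R :=
  f x + mu * t * (dot (grad f x) d + 1 / (2 * abar) * L * sqn d).

Definition armijo_ok (R : realType) (n : nat) (P : tbb_params R)
    (f : 'rV[R]_n -> R) (x d : 'rV[R]_n) (abar L t : R) : Prop :=
  f (x + t *: d) <= armijo_rhs f x d abar L (mu1 P) t /\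
  (gamma1 P <= t \/
   exists ts : R, [/\ gamma2 P * ts <= t, 0 < gamma2 P * ts
     & armijo_rhs f x d abar L (mu2 P) ts < f (x + ts *: d)]).

Definition direction (R : realType) (n : nat) (f : 'rV[R]_n -> R)
    (x : nat -> 'rV[R]_n) (abar : nat -> R) (k : nat) : 'rV[R]_n :=
  - abar k *: grad f (x k).

(* Differences at an index k >= 1. The predecessor on nat is truncated, so for
   k = 1 the term x k.-2 is x 0, which is the convention x_(-1) = x_0. *)
Definition s_1 (R : realType) (n : nat) (x : nat -> 'rV[R]_n) (k : nat) :
    'rV[R]_n := x k - x k.-1.

Definition s_2 (R : realType) (n : nat) (x : nat -> 'rV[R]_n) (k : nat) :
    'rV[R]_n := x k - x k.-2.

Definition y_1 (R : realType) (n : nat) (f : 'rV[R]_n -> R)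
    (x : nat -> 'rV[R]_n) (k : nat) : 'rV[R]_n :=
  grad f (x k) - grad f (x k.-1).

Definition y_2 (R : realType) (n : nat) (f : 'rV[R]_n -> R)
    (x : nat -> 'rV[R]_n) (k : nat) : 'rV[R]_n :=
  grad f (x k) - grad f (x k.-2).

Definition beta (R : realType) (n : nat) (f : 'rV[R]_n -> R)
    (x : nat -> 'rV[R]_n) (k : nat) : R :=
  dot (s_1 x k) (y_1 f x k) / sqn (y_1 f x k).

Definition alpha (R : realType) (n : nat) (v : variant) (f : 'rV[R]_n -> R)
    (x : nat -> 'rV[R]_n) (k : nat) : R :=
  alpha_of v (s_1 x k) (y_1 f x k) (s_2 x k) (y_2 f x k).

(* An infinite run of the method: iterates x_k, safeguarded step sizes
   \bar\alpha_k, numbers L_k and line-search step sizes \lambda_k. *)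
Record tbb_run (R : realType) (n : nat) (P : tbb_params R) (v : variant)
    (f : 'rV[R]_n -> R) (x : nat -> 'rV[R]_n) (abar L lam : nat -> R) : Prop :=
  TBBRun {
  run_init : abar 0%N = 1;
  run_nonstop : forall k, grad f (x k) != 0;
  run_L : forall k, let d := direction f x abar k in
    0 <= L k <= abar k * - dot (grad f (x k)) d / sqn d;
  run_lam : forall k, let ok := armijo_ok P f (x k) (direction f x abar k)
                                  (abar k) (L k) in
    exists p : nat, [/\ lam k = omega P ^+ p, ok (lam k)
      & forall q : nat, (q < p)%N -> ~ ok (omega P ^+ q)];
  run_step : forall k, x k.+1 = x k + lam k *: direction f x abar k;
  run_beta_defined : forall k, (1 <= k)%N -> sqn (y_1 f x k) != 0;
  run_alpha_defined : forall k, (1 <= k)%N ->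
    alpha_defined v (s_1 x k) (y_1 f x k) (s_2 x k) (y_2 f x k);
  run_abar : forall k, (1 <= k)%N ->
    abar k = safeguard P (beta f x k) (alpha v f x k)
}.

(* Main.v *)
Require Import Defs.
From mathcomp Require Import all_boot all_order all_algebra.
From mathcomp Require Import boolp classical_sets reals ereal topology.
From mathcomp Require Import normedtype sequences derive.
From mathcomp Require Import ring lra.
Set Implicit Arguments.
Unset Strict Implicit.
Unset Printing Implicit Defensive.
Import Order.TTheory GRing.Theory Num.Theory.
Import numFieldNormedType.Exports.
Local Open Scope classical_set_scope.
Local Open Scope ring_scope.

(** The line search makes every step decrease f by at least mu1 / 2 times
    lam_k abar_k |g_k|^2, where g_k is the gradient at x_k, because the
    condition on L_k keeps the Armijo slope between - abar_k |g_k|^2 and half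
    of that ([armijo_slope_itv], [descent]).

    Suppose that f z <= f (x_k) for all k. Since f (x_k) is strictly
    decreasing, pseudo-convexity says that - g_k makes an acute angle with
    z - x_k, so a step can increase |x_k - z|^2 by at most the squared step
    length. As lam_k <= 1 and abar_k <= amax, this is at most a constant times
    the decrease of f. Hence |x_k - z|^2 + C f (x_k) is nonincreasing for a
    suitable C ([potential_nonincreasing]). It follows that the iterates are
    bounded ([bounded_of_minorant]). It also follows that they converge to any
    of their cluster points xs: f xs <= f (x_k) for all k, so xs may serve as
    z, and a nonincreasing sequence of values of a continuous function
    converges to its value at the cluster point ([monotone_cluster],
    [cvg_of_cluster]).

    The limit is stationary ([limit_stationary]). Otherwise |g_k| stays away
    from 0 while f (x_k) - f (x_k.+1) tends to 0, so lam_k tends to 0; a step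
    size below gamma1 is accepted only if a comparably short trial step
    violates the Armijo inequality with mu2, and by the mean value theorem
    there is then a point near x_k where the component of the gradient along
    g_k is at most mu2 |g_k| ([short_step_turns_gradient]). As mu2 < 1, this
    contradicts the continuity of the gradient ([grad_nearly_constant]). By
    pseudo-convexity a stationary point is a solution.

    So a bounded run converges to a solution, and a run whose values are
    bounded below by some f z is bounded. The three claims follow: if f (x_k)
    did not tend to the infimum of f, some z would have f z below the limit of
    f (x_k), the run would converge to a solution, and f z would be less than
    the minimum. *)

(** * Euclidean inner product *)

Lemma dotC (R : realType) (n : nat) (u v : 'rV[R]_n) : dot u v = dot v u.
Proof. by apply: eq_bigr => i _; rewrite mulrC. Qed.

Lemma dotDr (R : realType) (n : nat) (u v w : 'rV[R]_n) :
  dot u (v + w) = dot u v + dot u w.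
Proof. by rewrite -big_split; apply: eq_bigr => i _; rewrite mxE mulrDr. Qed.

Lemma dotZr (R : realType) (n : nat) (a : R) (u v : 'rV[R]_n) :
  dot u (a *: v) = a * dot u v.
Proof. by rewrite /dot mulr_sumr; apply: eq_bigr => i _; rewrite mxE mulrCA. Qed.

Lemma dot0l (R : realType) (n : nat) (u : 'rV[R]_n) : dot 0 u = 0.
Proof. by rewrite /dot big1// => i _; rewrite mxE mul0r. Qed.

Lemma sqnZ (R : realType) (n : nat) (a : R) (u : 'rV[R]_n) :
  sqn (a *: u) = a ^+ 2 * sqn u.
Proof. by rewrite /sqn dotZr dotC dotZr; ring. Qed.

Lemma sqnD (R : realType) (n : nat) (u v : 'rV[R]_n) :
  sqn (u + v) = sqn u + 2 * dot u v + sqn v.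
Proof.
by rewrite /sqn dotDr (dotC (u + v) u) (dotC (u + v) v) !dotDr (dotC v u); ring.
Qed.

Lemma sqn_ge0 (R : realType) (n : nat) (u : 'rV[R]_n) : 0 <= sqn u.
Proof. by apply: sumr_ge0 => i _; rewrite -expr2 sqr_ge0. Qed.

(** The norm on row vectors is the sup norm; this bound transfers boundedness
    and convergence from the Euclidean distance to it. *)
Lemma norm_sqr_le_sqn (R : realType) (n : nat) (u : 'rV[R]_n) :
  `|u| ^+ 2 <= sqn u.
Proof.
have [->|/mx_norm_neq0 [[i j] /= uij]] := eqVneq `|u| 0.
  by rewrite expr0n sqn_ge0.
rewrite {1}/Num.norm/= uij real_normK ?num_real// (ord1 i) /sqn /dot.
rewrite (bigD1 j)//= -expr2 lerDl.
by apply: sumr_ge0 => l _; rewrite -expr2 sqr_ge0.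
Qed.

Lemma sqn_gt0 (R : realType) (n : nat) (u : 'rV[R]_n) : (0 < sqn u) = (u != 0).
Proof.
have [->|u0] := eqVneq u 0; first by rewrite /sqn dot0l ltxx.
by rewrite (lt_le_trans _ (norm_sqr_le_sqn _))// exprn_gt0// normr_gt0.
Qed.

Lemma cvg_dot (R : realType) (n : nat) (T : Type) (F : set_system T)
    {FF : Filter F} (u v : T -> 'rV[R]_n) (a b : 'rV[R]_n) :
  u @ F --> a -> v @ F --> b -> dot (u t) (v t) @[t --> F] --> dot a b.
Proof.
move=> ua vb; apply: cvg_big => [|i _]; first exact: add_continuous.
have coord (w : T -> 'rV[R]_n) (c : 'rV[R]_n) :
    w @ F --> c -> w t 0 i @[t --> F] --> c 0 i.
  by move=> wc; apply: (cvg_comp w (fun y => y 0 i) wc); exact: coord_continuous.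
by apply: cvgM; apply: coord.
Qed.

(** * Gradients and cluster points *)

Lemma derive_dot_grad (R : realType) (n : nat) (f : 'rV[R]_n -> R)
    (x d : 'rV[R]_n) :
  differentiable f x -> 'D_d f x = dot (grad f x) d.
Proof.
move=> df; rewrite deriveE// {1}(row_sum_delta d) linear_sum.
by apply: eq_bigr => i _; rewrite linearZ mxE -deriveE// mulrC.
Qed.

Lemma mean_value_line (R : realType) (n : nat) (f : 'rV[R]_n -> R)
    (x d : 'rV[R]_n) (t : R) :
  (forall y, differentiable f y) -> 0 < t ->
  exists2 c : R, 0 < c < t &
    f (x + t *: d) - f x = t * dot (grad f (x + c *: d)) d.
Proof.
move=> df t0; pose phi s := f (x + s *: d).
have dphi (s : R) : is_derive s 1 phi (dot (grad f (x + s *: d)) d).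
  have quotE : (fun h => h^-1 *: ((phi \o shift s) (h *: 1) - phi s)) =
      (fun h => h^-1 *: ((f \o shift (x + s *: d)) (h *: d) - f (x + s *: d))).
    apply/funext => h /=; congr (_ *: (f _ - _)).
    by rewrite /shift/= [h *: 1]mulr1 scalerDl addrCA.
  rewrite -derive_dot_grad//; apply: DeriveDef; last by rewrite /derive quotE.
  by rewrite /derivable quotE; exact: diff_derivable.
have [|c ct] := @MVT R phi (fun s => dot (grad f (x + s *: d)) d) 0 t t0
  (fun s _ => dphi s).
  apply: continuous_subspaceT => s.
  apply: differentiable_continuous; apply/derivable1_diffP.
  by have [] := dphi s.
by rewrite /phi scale0r addr0 subr0 mulrC => ->; exists c.
Qed.

(** Being near xs infinitely often, the sequence takes values h (x k) close to
    h xs infinitely often; monotonicity turns this into convergence. *)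
Lemma monotone_cluster (R : realType) (T : topologicalType) (h : T -> R)
    (x : nat -> T) (xs : T) :
  {homo h \o x : m k / (m <= k)%N >-> k <= m} ->
  cluster (x @ \oo) xs -> {for xs, continuous h} ->
  (forall k, h xs <= h (x k)) /\ h (x k) @[k --> \oo] --> h xs.
Proof.
move=> hx clx hc.
have ge k : h xs <= h (x k).
  rewrite leNgt; apply/negP => lt_hk.
  have [|y [/= [j kj <-] ltj]] := clx [set x j | j in [set j | (k <= j)%N]]
    [set y | h (x k) < h y] _ (cvgr_gt _ hc _ lt_hk).
    by exists k => // j /= kj; exists j.
  by have := hx _ _ kj; rewrite /= leNgt ltj.
split=> //; apply/cvgrPdist_lt => e e0.
have lt_e : h xs < h xs + e by rewrite ltrDl.
have [|y [/= [j _ <-] ltj]] := clx [set x j | j in setT]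
  [set y | h y < h xs + e] _ (cvgr_lt _ hc _ lt_e).
  by exists 0%N => // j _; exists j.
exists j => // i /= ji; rewrite distrC ger0_norm ?subr_ge0// ltrBlDl.
by apply: le_lt_trans ltj; exact: hx.
Qed.

(** At y = z = xs the gap between the two sides is (1 - mu) |grad f xs|^2 > 0,
    and it depends continuously on (y, z). *)
Lemma grad_nearly_constant (R : realType) (n : nat) (f : 'rV[R]_n -> R)
    (xs : 'rV[R]_n) (mu : R) :
  continuous (grad f) -> grad f xs != 0 -> mu < 1 ->
  exists2 r, 0 < r & forall y z, `|xs - y| < r -> `|xs - z| < r ->
    mu * sqn (grad f z) < dot (grad f y) (grad f z).
Proof.
move=> gc gs0 mu1.
have g1 : grad f p.1 @[p --> (xs, xs)] --> grad f xs.
  by apply: (@cvg_comp _ _ _ fst (grad f)); [exact: cvg_fst|exact: gc].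
have g2 : grad f p.2 @[p --> (xs, xs)] --> grad f xs.
  by apply: (@cvg_comp _ _ _ snd (grad f)); [exact: cvg_snd|exact: gc].
have gap_cvg : dot (grad f p.1) (grad f p.2) - mu * sqn (grad f p.2)
    @[p --> (xs, xs)] --> sqn (grad f xs) - mu * sqn (grad f xs).
  exact: (cvgB (cvg_dot g1 g2) (cvgM (cvg_cst mu) (cvg_dot g2 g2))).
have gap : 0 < sqn (grad f xs) - mu * sqn (grad f xs).
  by rewrite -[X in _ < X - _]mul1r -mulrBl mulr_gt0 ?subr_gt0 ?sqn_gt0.
have : nbhs (xs, xs)
    [set p | 0 < dot (grad f p.1) (grad f p.2) - mu * sqn (grad f p.2)].
  exact: (cvgr_gt _ gap_cvg _ gap).
move=> /nbhs_ballP[r /= r0 rP]; exists r => // y z ry rz; rewrite -subr_gt0.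
by apply: (rP (y, z)); split; rewrite /= -ball_normE.
Qed.

(** * One iteration *)

(** The truncation interval lies within [amin, amax], and it is not empty
    because it contains b: amin <= b <= amax and sigma1 < 1 < sigma2. *)
Lemma safeguard_itv (R : realType) (P : tbb_params R) (b a : R) :
  valid_params P -> amin P <= b <= amax P ->
  amin P <= safeguard P b a <= amax P.
Proof.
move=> HP /andP[minb bmax].
have amin0 := amin_gt0 HP; have aminmax := amin_lt_amax HP.
have /andP[s10 s11] := sigma1_itv HP; have /andP[s21 _] := sigma2_itv HP.
have b0 : 0 < b by lra.
rewrite /safeguard gtr0_norm//.
set lo := Num.max _ _; set hi := Num.min _ _.
have s1b : sigma1 P * b <= b by rewrite ler_piMl// ltW.
have s2b : b <= sigma2 P * b by rewrite ler_peMl// ltW.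
have lo_ge : amin P <= lo by rewrite le_max lexx.
have hi_le : hi <= amax P by rewrite ge_min lexx.
have lo_le : lo <= b by rewrite ge_max minb.
have hi_ge : b <= hi by rewrite le_min bmax.
by case: ifP => [/andP[]|_]; [|case: ifP => _]; lra.
Qed.

Section Run.
Context (R : realType) (n : nat) (P : tbb_params R) (v : variant).
Context (f : 'rV[R]_n -> R) (x : nat -> 'rV[R]_n) (abar L lam : nat -> R).
Context (HP : valid_params P) (run : tbb_run P v f x abar L lam).
Context (beta_itv : forall k : nat, (1 <= k)%N ->
  amin P <= beta f x k <= amax P).
Context (one_itv : amin P <= 1 <= amax P).

Local Notation g k := (grad f (x k)).
Local Notation d k := (direction f x abar k).

Let mu1_gt0 : 0 < mu1 P. Proof. by have /andP[] := mu1_itv HP. Qed.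

Lemma abar_itv (k : nat) : amin P <= abar k <= amax P.
Proof.
case: k => [|k]; first by rewrite (run_init run).
by rewrite (run_abar run)//; apply: safeguard_itv => //; exact: beta_itv.
Qed.

Lemma abar_gt0 (k : nat) : 0 < abar k.
Proof. by have /andP[] := abar_itv k; have := amin_gt0 HP; lra. Qed.

Lemma lam_itv (k : nat) : 0 < lam k <= 1.
Proof.
have /andP[w0 w1] := omega_itv HP.
have [p [-> _ _]] := run_lam run k.
by rewrite exprn_gt0//= exprn_ile1// ltW.
Qed.

Lemma sqn_grad_gt0 (k : nat) : 0 < sqn (g k).
Proof. by rewrite sqn_gt0 (run_nonstop run). Qed.

(** The condition on L k amounts to 0 <= L k <= 1, as the direction is
    - abar k times the gradient; the correction term is then L k / 2 times
    abar k |g|^2. *)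
Lemma armijo_slope_itv (k : nat) :
  - (abar k * sqn (g k)) <=
    dot (g k) (d k) + 1 / (2 * abar k) * L k * sqn (d k)
  <= - (abar k * sqn (g k) / 2).
Proof.
have a0 := abar_gt0 k; have q0 := sqn_grad_gt0 k.
have := run_L run k; rewrite /= /direction dotZr sqnZ -/(sqn (g k)) sqrrN.
set q := sqn (g k) in q0 *; set a := abar k in a0 *.
have -> : a * - (- a * q) / (a ^+ 2 * q) = 1.
  by field; rewrite !gt_eqF.
move=> /andP[L0 L1].
have -> : - a * q + 1 / (2 * a) * L k * (a ^+ 2 * q) =
    - (a * q) + L k * (a * q) / 2 by field; rewrite gt_eqF.
have aq0 : 0 < a * q by rewrite mulr_gt0.
have Laq0 : 0 <= L k * (a * q) by rewrite mulr_ge0// ltW.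
have Laq1 : L k * (a * q) <= a * q by rewrite ler_piMl// ltW.
by apply/andP; split; lra.
Qed.

Lemma descent (k : nat) :
  f (x k.+1) <= f (x k) - mu1 P / 2 * (lam k * abar k * sqn (g k)).
Proof.
have [p [_ [dec _] _]] := run_lam run k.
rewrite (run_step run); apply: le_trans dec _; rewrite /armijo_rhs.
have /andP[_ slope] := armijo_slope_itv k.
have /andP[l0 _] := lam_itv k.
by have := ler_wpM2l (ltW (mulr_gt0 mu1_gt0 l0)) slope; lra.
Qed.

Lemma f_decreasing (k : nat) : f (x k.+1) < f (x k).
Proof.
have := descent k; have /andP[l0 _] := lam_itv k.
have : 0 < mu1 P / 2 * (lam k * abar k * sqn (g k)).
  by rewrite !mulr_gt0 ?invr_gt0 ?abar_gt0 ?sqn_grad_gt0.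
by lra.
Qed.

Lemma f_nonincreasing : {homo f \o x : m k / (m <= k)%N >-> k <= m}.
Proof. by apply/nonincreasing_seqP => k /=; exact/ltW/f_decreasing. Qed.

(** * Fejer monotonicity and convergence *)

(** The weight of f is what makes the decrease of f guaranteed by [descent]
    outweigh the squared length lam^2 abar^2 |g|^2 of a step, given lam <= 1
    and abar <= amax. *)
Definition fejer_potential (z y : 'rV[R]_n) : R :=
  sqn (y - z) + 2 * amax P / mu1 P * f y.

(** Expanding |x_k.+1 - z|^2 gives a cross term, negative by pseudo-convexity,
    and the squared step length, which the decrease of f compensates. *)
Lemma potential_nonincreasing (z : 'rV[R]_n) :
  pseudo_convex f -> (forall k, f z <= f (x k)) ->
  {homo fejer_potential z \o x : m k / (m <= k)%N >-> k <= m}.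
Proof.
move=> [_ pcf] zmin; apply/nonincreasing_seqP => k /=.
have a0 := abar_gt0 k; have /andP[_ amaxk] := abar_itv k.
have /andP[l0 l1] := lam_itv k; have q0 := sqn_grad_gt0 k.
(* f z < f (x k) is strict because f z <= f (x k.+1) < f (x k). *)
have desc : dot (g k) (z - x k) < 0.
  by apply: pcf; apply: le_lt_trans (f_decreasing k).
rewrite /fejer_potential (run_step run) addrAC [sqn (x k - z + _)]sqnD.
rewrite -(run_step run) dotZr sqnZ.
rewrite /direction dotZr sqnZ sqrrN [dot (x k - z) _]dotC.
have -> : x k - z = -1 *: (z - x k) by rewrite scaleN1r opprB.
rewrite dotZr sqnZ sqrrN expr1n mul1r.
have cross : 2 * (lam k * (- abar k * (-1 * dot (g k) (z - x k)))) <= 0.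
  have : lam k * abar k * dot (g k) (z - x k) <= 0.
    by rewrite pmulr_rle0 ?mulr_gt0// ltW.
  by lra.
have quad : lam k ^+ 2 * (abar k ^+ 2 * sqn (g k)) <=
    amax P * (lam k * abar k * sqn (g k)).
  have la : lam k * abar k <= amax P.
    by rewrite (le_trans _ amaxk)// ler_piMl// ltW.
  have -> : lam k ^+ 2 * (abar k ^+ 2 * sqn (g k)) =
    (lam k * abar k) * (lam k * abar k * sqn (g k)) by ring.
  by apply: ler_wpM2r la; rewrite !mulr_ge0// ltW.
have C0 : 0 < 2 * amax P / mu1 P.
  by rewrite divr_gt0// mulr_gt0//; have /andP[] := abar_itv k; lra.
have := ler_wpM2l (ltW C0) (descent k).
have -> : 2 * amax P / mu1 P *
    (f (x k) - mu1 P / 2 * (lam k * abar k * sqn (g k))) =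
  2 * amax P / mu1 P * f (x k) - amax P * (lam k * abar k * sqn (g k)).
  by field; rewrite gt_eqF.
by lra.
Qed.

Lemma bounded_of_minorant (z : 'rV[R]_n) :
  pseudo_convex f -> (forall k, f z <= f (x k)) -> bounded_fun x.
Proof.
move=> pcf zmin.
have C0 : 0 < 2 * amax P / mu1 P.
  by rewrite divr_gt0// mulr_gt0//; have := abar_itv 0; have := abar_gt0 0; lra.
pose M := fejer_potential z (x 0) - 2 * amax P / mu1 P * f z.
have M0 k : sqn (x k - z) <= M.
  have := potential_nonincreasing pcf zmin (leq0n k).
  have := ler_wpM2l (ltW C0) (zmin k); rewrite /M /fejer_potential/=; lra.
exists (`|z| + M + 1); split; first exact: num_real.
move=> B ltB k _ /=; apply/ltW/(le_lt_trans _ ltB).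
rewrite -[x k](subrK z) addrC -addrA (le_trans (ler_normD _ _))// lerD2l.
(* t <= M + 1 follows from t^2 <= M, since 2 t <= t^2 + 1. *)
have := le_trans (norm_sqr_le_sqn (x k - z)) (M0 k).
have := sqr_ge0 (`|x k - z| - 1); have := sqr_ge0 `|x k - z|; nra.
Qed.

(** The value of the potential based at xs tends to its value at xs, which
    forces the squared distance to xs to tend to 0. *)
Lemma cvg_of_cluster (xs : 'rV[R]_n) :
  pseudo_convex f -> cluster (x @ \oo) xs ->
  [/\ forall k, f xs <= f (x k), f (x k) @[k --> \oo] --> f xs
    & x @ \oo --> xs].
Proof.
move=> pcf clx.
have fc : {for xs, continuous f}.
  by apply: differentiable_continuous; exact: pcf.1.
have [fmin fcvg] := monotone_cluster f_nonincreasing clx fc.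
split=> //.
have dc : {for xs, continuous (fejer_potential xs)}.
  have sub_cvg : y - xs @[y --> xs] --> xs - xs.
    exact: (@cvgB _ _ _ (nbhs xs) _ id (fun=> xs) xs xs cvg_id (cvg_cst xs)).
  have sqn_cvg : sqn (y - xs) @[y --> xs] --> sqn (xs - xs).
    exact: (cvg_dot sub_cvg sub_cvg).
  have f_cvg :
      2 * amax P / mu1 P * f y @[y --> xs] --> 2 * amax P / mu1 P * f xs.
    exact: (cvgM (cvg_cst _) fc).
  exact: (cvgD sqn_cvg f_cvg).
have [_ dcvg] := monotone_cluster (potential_nonincreasing pcf fmin) clx dc.
have scvg : sqn (x k - xs) @[k --> \oo] --> (0 : R).
  have -> : (fun k => sqn (x k - xs)) =
      (fun k => fejer_potential xs (x k) - 2 * amax P / mu1 P * f (x k)).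
    by apply/funext => k; rewrite /fejer_potential addrK.
  have -> : (0 : R) = fejer_potential xs xs - 2 * amax P / mu1 P * f xs.
    by rewrite /fejer_potential subrr /sqn dot0l addrK.
  exact: (cvgB dcvg (cvgM (cvg_cst _) fcvg)).
apply/cvgrPdist_lt => e e0.
near=> k; rewrite distrC -(@ltr_pXn2r _ 2)// ?nnegrE ?(ltW e0)//.
apply: le_lt_trans (norm_sqr_le_sqn _) _.
near: k; exact: (cvgr_lt _ scvg _ (exprn_gt0 2 e0)).
Unshelve. all: by end_near. Qed.

(** * Stationarity of the limit *)

(** A step size below gamma1 comes with a trial step t <= lam k / gamma2 that
    violates the mu2 inequality. The point y is given by the mean value theorem
    on the segment from x k to x k + t d, where d is the direction; the factor
    amax |g| bounds the length of d. *)
Lemma short_step_turns_gradient (k : nat) :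
  (forall y, differentiable f y) -> lam k < gamma1 P ->
  exists2 y, `|y - x k| <= lam k / gamma2 P * (amax P * `|g k|) &
    dot (grad f y) (g k) <= mu2 P * sqn (g k).
Proof.
move=> df lam_lt; have a0 := abar_gt0 k; have /andP[_ amaxk] := abar_itv k.
have [p [_ [_ [lam_ge|viol]] _]] := run_lam run k.
  by have := le_lt_trans lam_ge lam_lt; rewrite ltxx.
have {viol} [t [t_lam t0 viol]] := viol; have g20 := gamma2_gt0 HP.
have {}t0 : 0 < t by move: t0; rewrite pmulr_rgt0.
have [e /andP[e0 et] mv] := mean_value_line (x k) (d k) df t0.
exists (x k + e *: d k).
  rewrite addrC addKr /direction !normrZ normrN (gtr0_norm e0) (gtr0_norm a0).
  apply: ler_pM; [exact: ltW|by rewrite mulr_ge0// ltW| |exact: ler_wpM2r].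
  by rewrite ler_pdivlMr// mulrC (le_trans _ t_lam)// ler_pM2l// ltW.
have {mv} viol : mu2 P *
      (dot (g k) (d k) + 1 / (2 * abar k) * L k * sqn (d k)) <
    - (abar k * dot (grad f (x k + e *: d k)) (g k)).
  rewrite -mulNr -[- abar k * _]dotZr -(ltr_pM2l t0) -mv ltrBrDl.
  by move: viol; rewrite /armijo_rhs mulrCA mulrA.
have /andP[slope _] := armijo_slope_itv k.
have /andP[mu20 _] := mu2_itv HP.
rewrite -(ler_pM2l a0) -lerN2 (mulrCA (abar k)) -mulrN ltW//.
exact: le_lt_trans (ler_wpM2l (ltW mu20) slope) viol.
Qed.

(** If the gradient at xs were nonzero, a single late iteration k would give
    the contradiction: lam k is then so small that the point y of
    [short_step_turns_gradient] falls in the neighbourhood where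
    [grad_nearly_constant] applies. *)
Lemma limit_stationary (xs : 'rV[R]_n) :
  continuously_differentiable f -> (forall k, f xs <= f (x k)) ->
  f (x k) @[k --> \oo] --> f xs -> x @ \oo --> xs -> grad f xs = 0.
Proof.
move=> [df gc] fmin fcvg xcvg; apply/eqP/negPn/negP => gs0.
have /andP[_ mu2_lt1] := mu2_itv HP.
have [r r0 align] := grad_nearly_constant gc gs0 mu2_lt1.
have q0 : 0 < sqn (grad f xs) by rewrite sqn_gt0.
have amin0 := amin_gt0 HP.
have amax0 : 0 < amax P by exact: lt_trans amin0 (amin_lt_amax HP).
have g20 := gamma2_gt0 HP.
pose B := `|grad f xs| + 1.
have B0 : 0 < B by rewrite ltr_wpDl.
(* c * lam k is a lower bound for the decrease of f at iterations near xs. *)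
pose c := mu1 P / 2 * (amin P * (sqn (grad f xs) / 2)).
have c0 : 0 < c by rewrite !mulr_gt0 ?invr_gt0.
(* Below delta, the line search has backtracked, and the point where the
   gradient has turned is within r / 2 of the iterate. *)
pose delta := Num.min (gamma1 P) (gamma2 P * (r / 2 / (amax P * B))).
have delta0 : 0 < delta.
  by rewrite lt_min (gamma1_gt0 HP)/= mulr_gt0 ?divr_gt0 ?mulr_gt0.
have gcvg : grad f (x k) @[k --> \oo] --> grad f xs.
  by apply: (@cvg_comp _ _ _ x (grad f)) xcvg _; exact: gc.
have half_lt : sqn (grad f xs) / 2 < sqn (grad f xs).
  by rewrite gtr_pMr// invf_lt1 ?ltr1n.
have B_gt : `|grad f xs| < B by rewrite ltrDl.
have f_gt : f xs < f xs + c * delta by rewrite ltrDl mulr_gt0.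
have [k [xk qk Bk fk]] : exists k, [/\ `|xs - x k| < r / 2,
    sqn (grad f xs) / 2 < sqn (g k), `|g k| < B & f (x k) < f xs + c * delta].
  near \oo => k; exists k; split.
  - by near: k; move/cvgrPdist_lt: xcvg; apply; rewrite divr_gt0.
  - by near: k; exact: (cvgr_gt _ (cvg_dot gcvg gcvg) _ half_lt).
  - by near: k; exact: (cvgr_norm_lt _ gcvg _ B_gt).
  - by near: k; exact: (cvgr_lt _ fcvg _ f_gt).
have /andP[ak amaxk] := abar_itv k; have /andP[l0 _] := lam_itv k.
have lam_lt : lam k < delta.
  have decr : mu1 P / 2 * (lam k * abar k * sqn (g k)) < c * delta.
    rewrite -(ltrD2l (f xs)); apply: le_lt_trans fk.
    by rewrite -lerBrDr (le_trans (fmin k.+1))// descent.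
  rewrite -(ltr_pM2l c0); apply: le_lt_trans decr.
  have -> : c * lam k =
      mu1 P / 2 * (lam k * (amin P * (sqn (grad f xs) / 2))).
    by rewrite /c; ring.
  rewrite -[lam k * abar k * _]mulrA ler_pM2l ?divr_gt0// ler_pM2l//.
  by apply: ler_pM => //; [exact: ltW|rewrite divr_ge0// ltW|exact: ltW].
move: lam_lt; rewrite lt_min => /andP[lam_g1 lam_g2].
have [y yk] := short_step_turns_gradient df lam_g1.
apply/negP; rewrite -ltNge; apply: align; last first.
  by apply: lt_trans xk _; rewrite gtr_pMr// invf_lt1 ?ltr1n.
rewrite -(subrKA (x k)) (splitr r) (le_lt_trans (ler_normD _ _))// ltrD//.
rewrite distrC (le_lt_trans yk)//.
have : lam k / gamma2 P < r / 2 / (amax P * B) by rewrite ltr_pdivrMr// mulrC.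
rewrite ltr_pdivlMr ?mulr_gt0//; apply: le_lt_trans.
by rewrite ler_pM2l ?divr_gt0// ler_pM2l// ltW.
Unshelve. all: by end_near. Qed.

(** * Optimality *)

(** At a stationary point the inequality of pseudo-convexity reads 0 < 0 unless
    the point is a minimizer. *)
Lemma solution_of_cluster (xs : 'rV[R]_n) :
  continuously_differentiable f -> pseudo_convex f -> cluster (x @ \oo) xs ->
  [/\ solutions f xs, f (x k) @[k --> \oo] --> f xs & x @ \oo --> xs].
Proof.
move=> fC1 pcf /(cvg_of_cluster pcf)[fmin fcvg xcvg]; split=> // y.
rewrite leNgt; apply/negP => /(pcf.2 _ _).
by rewrite (limit_stationary fC1 fmin fcvg xcvg) dot0l ltxx.
Qed.

Lemma solution_of_bounded :
  continuously_differentiable f -> pseudo_convex f -> bounded_fun x ->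
  exists2 xs, solutions f xs & f (x k) @[k --> \oo] --> f xs.
Proof.
move=> fC1 pcf [M [_ xM]].
have xB k : `|x k| <= `|M| + 1.
  by apply: (xM _ _ k I); rewrite (le_lt_trans (ler_norm _))// ltrDl.
have B0 : 0 < `|M| + 1 by rewrite ltr_wpDl.
have cpt : compact (closed_ball (0 : 'rV[R]_n) (`|M| + 1)).
  apply: bounded_closed_compact; last exact: closed_ball_closed.
  exists (`|M| + 1); split; first exact: num_real.
  move=> N MN y; rewrite closed_ballE//= /closed_ball_/= sub0r normrN => yM.
  exact: le_trans (ltW MN).
have [|xs [_ clx]] := cpt (x @ \oo) _.
  by exists 0%N => // k _ /=; rewrite closed_ballE// /closed_ball_/= sub0r normrN.
by have [? ? _] := solution_of_cluster fC1 pcf clx; exists xs.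
Qed.

End Run.

Theorem theorem2 (R : realType) (n : nat) (P : tbb_params R) (v : variant)
    (f : 'rV[R]_n -> R) (x : nat -> 'rV[R]_n) (abar L lam : nat -> R)
    (HP : valid_params P)
    (f_C1 : continuously_differentiable f)
    (f_pc : pseudo_convex f)
    (run : tbb_run P v f x abar L lam)
    (beta_itv : forall k : nat, (1 <= k)%N -> amin P <= beta f x k <= amax P)
    (one_itv : amin P <= 1 <= amax P)
    (lam_sup : (ereal_sup [set (lam k)%:E | k in [set k | (1 <= k)%N]] < +oo)%E) :
  [/\ bounded_fun x <-> solutions f !=set0,
      (f (x k))%:E @[k --> \oo] --> ereal_inf (range (fun z => (f z)%:E))
    & solutions f !=set0 ->
      forall xs : 'rV[R]_n, cluster (x @ \oo) xs ->
        solutions f xs /\ x @ \oo --> xs].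
Proof.
have bounded z := @bounded_of_minorant _ _ _ _ _ _ _ _ _ HP run beta_itv
  one_itv z f_pc.
have bounded_sol := solution_of_bounded HP run beta_itv one_itv f_C1 f_pc.
split.
- split=> [/bounded_sol[xs sol _]|[z sol]]; first by exists xs.
  exact: (bounded z).
- pose m := ereal_inf (range (fun k => (f (x k))%:E)).
  have mcvg : (f (x k))%:E @[k --> \oo] --> m.
    apply: ereal_nonincreasing_cvgn => i j ij.
    by rewrite lee_fin; exact: (f_nonincreasing HP run).
  have -> : ereal_inf (range (fun z => (f z)%:E)) = m; last by [].
  apply/eqP; rewrite eq_le; apply/andP; split.
    by apply: ereal_inf_le_tmp => _ [k _ <-]; exists (x k).
  apply: le_ereal_inf_tmp => _ [z _ <-]; rewrite leNgt; apply/negP => z_lt.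
  have z_min k : f z <= f (x k).
    rewrite -lee_fin (le_trans (ltW z_lt))//.
    by apply: ereal_inf_lbound; exists k.
  have [xs sol fcvg] := bounded_sol (bounded z z_min).
  have fcvgE : (f (x k))%:E @[k --> \oo] --> (f xs)%:E.
    by apply/fine_cvgP; split; [exact: nearW|exact: fcvg].
  have mE := cvg_unique (@ereal_hausdorff R) mcvg fcvgE.
  by move: z_lt; rewrite mE lte_fin ltNge sol.
- move=> _ xs clx.
  by have [] := solution_of_cluster HP run beta_itv one_itv f_C1 f_pc clx.
Qed.
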